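(* Let $G=(V,E)$ be an undirected connected graph, let $S\subset V$ and $|S|=2$. Then $S$ is a minimum perfect critical set (that is, a minimum perfect critical $2$ set) of $G$ if and only if, for every $v\in\overline{S}=V\setminus S$, either $N_S(v)=\emptyset$ or $N_S(v)=S$.
   Context: Graphs are finite, undirected, unweighted and simple. For a graph $G=(V,E)$ with $V=\{v_1,\dots,v_n\}$, the Laplacian is $L=\Delta(G)-D(G)$, where $\Delta(G)$ is the diagonal matrix of vertex degrees and $D(G)$ is the $0$-$1$ adjacency matrix. For $S\subset V$ put $\overline{S}=V\setminus S$, and for $v\in V$ let $N_S(v)=\{u\in S: uv\in E\}$. For a vector $y$ indexed by $V$, $y_S$ denotes the vector obtained from $y$ by deleting the entries indexed by $\overline{S}$; eigenvectors are nonzero. A nonempty $S\subseteq V$ is a critical set if there is an eigenvector $y$ of $L$ with $y_{\overline{S}}=0$. A critical set $S$ is a perfect critical set if there is an eigenvector $y$ of $L$ with $y_{\overline{S}}=0$ and $y_v\neq 0$ for every $v\in S$. A perfect critical set is a minimum perfect critical set if no proper subset of it is a perfect critical set. It is called a minimum perfect critical $k$ set if moreover $|S|=k$. *)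

(* Defs.v *)
From mathcomp Require Import all_boot all_order all_algebra.
From mathcomp Require Import reals.
Set Implicit Arguments.
Unset Strict Implicit.
Unset Printing Implicit Defensive.
Import GRing.Theory.
Local Open Scope ring_scope.

(* A simple graph on the vertices v_1, ..., v_n is a symmetric irreflexive
   relation [e : rel 'I_n]; both properties are hypotheses of the theorem
   rather than part of the definitions below. *)

Definition connected_graph (n : nat) (e : rel 'I_n) : Prop :=
  forall u v : 'I_n, connect e u v.

Definition nbrs (n : nat) (e : rel 'I_n) (S : {set 'I_n}) (v : 'I_n) :
    {set 'I_n} :=
  [set u in S | e u v].

Definition degree (n : nat) (e : rel 'I_n) (v : 'I_n) : nat :=
  #|nbrs e [set: 'I_n] v|.

Definition degree_mx (R : realType) (n : nat) (e : rel 'I_n) : 'M[R]_n :=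
  diag_mx (\row_i (degree e i)%:R).

Definition adjacency_mx (R : realType) (n : nat) (e : rel 'I_n) : 'M[R]_n :=
  \matrix_(i, j) (e i j)%:R.

Definition laplacian (R : realType) (n : nat) (e : rel 'I_n) : 'M[R]_n :=
  degree_mx R e - adjacency_mx R e.

(* Column-vector convention, A y = lambda y; the library's [eigenspace] is
   stated for row vectors. *)
Definition eigenvector (R : realType) (n : nat) (A : 'M[R]_n) (y : 'cV[R]_n) :
    Prop :=
  y != 0 /\ exists lambda : R, A *m y = lambda *: y.

Definition vanishes_outside (R : realType) (n : nat) (S : {set 'I_n})
    (y : 'cV[R]_n) : Prop :=
  forall v : 'I_n, v \notin S -> y v 0 = 0.

Definition critical_set (R : realType) (n : nat) (e : rel 'I_n)
    (S : {set 'I_n}) : Prop :=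
  S != set0 /\
  exists y : 'cV[R]_n, eigenvector (laplacian R e) y /\ vanishes_outside S y.

Definition perfect_critical_set (R : realType) (n : nat) (e : rel 'I_n)
    (S : {set 'I_n}) : Prop :=
  critical_set R e S /\
  exists y : 'cV[R]_n,
    [/\ eigenvector (laplacian R e) y,
        vanishes_outside S y
      & forall v : 'I_n, v \in S -> y v 0 != 0].

Definition minimum_perfect_critical_set (R : realType) (n : nat)
    (e : rel 'I_n) (S : {set 'I_n}) : Prop :=
  perfect_critical_set R e S /\
  forall T : {set 'I_n}, T \proper S -> ~ perfect_critical_set R e T.

(* Main.v *)
(* On a vertex v outside S, the v-th entry of L y is minus the sum of y over
   N_S(v), so for S = {a, b} and y nonzero exactly on S, v cannot be adjacent to
   exactly one of a, b.  Conversely, if no outer vertex separates a from b, then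
   swapping a and b preserves adjacency, so deg a = deg b and the difference of
   the indicators of a and b is an eigenvector.  A singleton is never perfect
   critical, since its vertex would be isolated. *)
Require Import Defs.
From mathcomp Require Import all_boot all_order all_fingroup all_algebra.
From mathcomp Require Import reals.

Import GRing.Theory.
Local Open Scope ring_scope.

Lemma laplacian_mulE (R : realType) (n : nat) (e : rel 'I_n) (y : 'cV[R]_n)
    (i : 'I_n) :
  (laplacian R e *m y) i 0 =
  (degree e i)%:R * y i 0 - \sum_j (e i j)%:R * y j 0.
Proof.
rewrite /laplacian /degree_mx mulmxBl mul_diag_mx !mxE; congr (_ - _).
by apply: eq_bigr => j _; rewrite !mxE.
Qed.

Lemma sum_supported (R : realType) (n : nat) (S : {set 'I_n}) (y : 'cV[R]_n)
    (f : 'I_n -> R) :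
  vanishes_outside S y -> \sum_j f j * y j 0 = \sum_(j in S) f j * y j 0.
Proof.
move=> y0; rewrite (bigID (mem S)) /= [X in _ + X]big1 ?addr0 // => j jS.
by rewrite y0 ?mulr0.
Qed.

(** As [y v 0 = 0], both the degree term and the eigenvalue term vanish in row [v], whatever the
    eigenvalue is. *)
Lemma eigenvector_adj_sum0 (R : realType) (n : nat) (e : rel 'I_n)
    (S : {set 'I_n}) (y : 'cV[R]_n) (v : 'I_n) :
  eigenvector (laplacian R e) y -> vanishes_outside S y -> v \notin S ->
  \sum_(j in S) (e v j)%:R * y j 0 = 0.
Proof.
move=> [_ [l Ly]] y0 vS; have := laplacian_mulE R n e y v.
rewrite Ly mxE (y0 v vS) !mulr0 sub0r (sum_supported _ _ _ _ _ y0).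
by move/esym/eqP; rewrite oppr_eq0 => /eqP.
Qed.

Lemma connect_neighbor (T : finType) (e : rel T) (a b : T) :
  a != b -> connect e a b -> exists c, e a c.
Proof.
move=> ab /connectP[[|c p] /=]; first by move=> _ ba; rewrite ba eqxx in ab.
by case/andP=> eac _ _; exists c.
Qed.

(** The second vertex [b] and connectedness give [a] a neighbour [c]; the eigenvector equation at
    [c] then reads [y a 0 = 0]. *)
Lemma perfect_critical_set1F (R : realType) (n : nat) (e : rel 'I_n)
    (a b : 'I_n) :
  symmetric e -> irreflexive e -> connected_graph e -> a != b ->
  ~ perfect_critical_set R e [set a].
Proof.
move=> e_sym e_irr e_conn ab [_ [y [eig y0 yN0]]].
have [c eac] := connect_neighbor _ _ _ _ ab (e_conn a b).
have ca : c \notin [set a].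
  by rewrite inE; apply: contraTneq eac => ->; rewrite e_irr.
have := eigenvector_adj_sum0 _ _ _ _ _ _ eig y0 ca.
rewrite big_set1 e_sym eac mul1r => ya0.
by move: (yN0 a (set11 a)); rewrite ya0 eqxx.
Qed.

Lemma twin_degree (n : nat) (e : rel 'I_n) (a b : 'I_n) :
  symmetric e -> irreflexive e ->
  (forall v, v \notin [set a; b] -> e v a = e v b) -> degree e a = degree e b.
Proof.
move=> e_sym e_irr twin; rewrite /degree.
(* The transposition of [a] and [b] carries the neighbours of [a] onto those of [b]. *)
rewrite -[RHS](card_preimset _ (@perm_inj _ (tperm a b))).
apply: eq_card => u; rewrite !inE.
case: tpermP => [->|->|ua ub]; [by rewrite !e_irr | exact: e_sym |].
by rewrite twin // !inE negb_or; apply/andP; split; apply/eqP.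
Qed.

Lemma twin_eigenvector (R : realType) (n : nat) (e : rel 'I_n) (a b : 'I_n) :
  symmetric e -> irreflexive e -> a != b ->
  (forall v, v \notin [set a; b] -> e v a = e v b) ->
  eigenvector (laplacian R e) (delta_mx a 0 - delta_mx b 0).
Proof.
move=> e_sym e_irr ab twin; set y := _ - _.
have yE i : y i 0 = (i == a)%:R - (i == b)%:R by rewrite !mxE !andbT.
have y0 : vanishes_outside [set a; b] y.
  by move=> v; rewrite !inE yE => /norP[/negPf-> /negPf->]; rewrite subr0.
have ba : (b == a) = false by rewrite eq_sym (negPf ab).
split.
  apply/eqP => /matrixP/(_ a 0)/eqP.
  by rewrite yE mxE eqxx (negPf ab) subr0 oner_eq0.
(* The eigenvalue is read off row [a], where [y] is 1 at [a] and -1 at [b]. Row [b] agrees because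
   the degrees are equal; in any other row the two adjacency terms cancel. *)
exists ((degree e a)%:R + (e a b)%:R); apply/matrixP => i j.
rewrite (ord1 j) laplacian_mulE (sum_supported _ _ _ _ _ y0) [RHS]mxE.
rewrite big_setU1 ?inE //= big_set1 !yE !eqxx (negPf ab) ba.
rewrite subr0 sub0r mulr1 mulrN1.
have [->|ia] := eqVneq i a.
  by rewrite e_irr (negPf ab) subr0 !mulr1 sub0r opprK.
have [->|ib] := eqVneq i b.
  by rewrite e_irr (e_sym b) subr0 sub0r !mulrN1 opprD
             (twin_degree _ _ _ _ e_sym e_irr twin).
by rewrite twin ?inE ?negb_or ?ia ?ib // !subrr !mulr0 subrr.
Qed.

Local Close Scope ring_scope.

Theorem theorem2 (R : realType) (n : nat) (e : rel 'I_n)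
    (e_sym : symmetric e) (e_irr : irreflexive e)
    (e_conn : connected_graph e)
    (S : {set 'I_n}) (S_card2 : #|S| = 2) :
  minimum_perfect_critical_set R e S <->
  (forall v : 'I_n, v \notin S -> nbrs e S v = set0 \/ nbrs e S v = S).
Proof.
have [a [b [ab defS]]] : exists a b, a != b /\ S = [set a; b].
  by have /eqP/cards2P[a [b [ab ->]]] := S_card2; exists a, b.
split=> [[[_ [y [eig y0 yN0]]] _] v vS | nbrsS].
  have := eigenvector_adj_sum0 _ _ _ _ _ _ eig y0 vS.
  have [yaN0 ybN0] : y a 0%R != 0%R /\ y b 0%R != 0%R.
    by split; apply: yN0; rewrite defS !inE eqxx ?orbT.
  rewrite {1}defS big_setU1 ?inE //= big_set1 (e_sym v a) (e_sym v b).
  (* The two mixed cases leave a single entry of [y] equal to 0, contradicting perfection. *)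
  case eav: (e a v); case ebv: (e b v);
    rewrite ?mul1r ?mul0r ?addr0 ?add0r => h.
  - right; apply/setP => u; rewrite defS !inE.
    by case: eqVneq => [->|_]; [|case: eqVneq => [->|]]; rewrite ?eav ?ebv.
  - by rewrite h eqxx in yaN0.
  - by rewrite h eqxx in ybN0.
  - left; apply/setP => u; rewrite defS !inE.
    by case: eqVneq => [->|_]; [|case: eqVneq => [->|]]; rewrite ?eav ?ebv.
(* Whether N_S(v) is empty or all of [S], it contains both of [a], [b] or neither. *)
have twin v : v \notin [set a; b] -> e v a = e v b.
  rewrite -defS => /nbrsS; rewrite (e_sym v a) (e_sym v b) defS.
  by case=> /setP nv; have := nv a; have := nv b;
    rewrite !inE !eqxx orbT /= => -> ->.
have eig := twin_eigenvector R _ _ _ _ e_sym e_irr ab twin.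
have y0 : vanishes_outside S (delta_mx a 0 - delta_mx b 0 : 'cV[R]_n)%R.
  by move=> v; rewrite defS !inE !mxE => /norP[/negPf-> /negPf->]; rewrite subr0.
split.
  split; first by split; [rewrite -card_gt0 S_card2 | eexists; split; eauto].
  exists (delta_mx a 0 - delta_mx b 0)%R; split=> // v.
  rewrite defS !inE !mxE !andbT => /orP[]/eqP->.
    by rewrite eqxx (negPf ab) subr0 oner_neq0.
  by rewrite eqxx (eq_sym b) (negPf ab) sub0r oppr_eq0 oner_neq0.
move=> T TS perfT.
(* Critical sets are nonempty, so a critical proper subset of a pair is a singleton. *)
have /cards1P[c defT] : #|T| == 1.
  have [[TN0 _] _] := perfT.
  by rewrite eqn_leq card_gt0 TN0 andbT -ltnS -S_card2 proper_card.
(* Excluding the singleton takes a vertex other than [c]; one of [a], [b] serves. *)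
have [d cd] : exists d, c != d.
  by have [->|ca] := eqVneq c a; [exists b | exists a].
by rewrite defT in perfT; apply: perfect_critical_set1F cd perfT.
Qed.
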